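(* Let $X$ be a real Banach space and let $f:\mathbb{R}\to X$ be arbitrary. Then there exists a set $N\subset\mathbb{R}$ of Lebesgue measure zero such that: if $x\in\mathbb{R}\setminus N$ and $mD^+(f,x)<\infty$, then $md(f,x)$ exists and $md(f,x)=mD^+(f,x)$.
   Context: For $f:\mathbb{R}\to X$ and $x\in\mathbb{R}$: $mD^{+}(f,x)=\limsup_{t\to0+}\frac{\|f(x+t)-f(x)\|}{t}\in[0,+\infty]$. The unilateral metric derivatives are $md_{\pm}(f,x)=\lim_{t\to0+}\frac{\|f(x\pm t)-f(x)\|}{t}$ (when the limit exists). If $md_+(f,x)$ and $md_-(f,x)$ exist and are equal, one says that the metric derivative $md(f,x)$ exists and sets $md(f,x)=md_+(f,x)$. *)

(* Defs.v *)
From HB Require Import structures.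
From mathcomp Require Import all_boot all_order all_algebra.
From mathcomp Require Import all_classical all_reals all_analysis.

Set Implicit Arguments.
Unset Strict Implicit.
Unset Printing Implicit Defensive.

Import Order.TTheory GRing.Theory Num.Theory.
Import numFieldNormedType.Exports.

Local Open Scope classical_set_scope.
Local Open Scope ring_scope.

Definition rquot (R : realType) (X : normedModType R) (f : R -> X) (x t : R)
  : R := `|f (x + t) - f x| / t.

Definition lquot (R : realType) (X : normedModType R) (f : R -> X) (x t : R)
  : R := `|f (x - t) - f x| / t.

Definition mDplus (R : realType) (X : normedModType R) (f : R -> X) (x : R)
  : \bar R := limf_esup (fun t : R => (rquot f x t)%:E) 0^'+.

Definition md_plus_exists (R : realType) (X : normedModType R)
  (f : R -> X) (x : R) : Prop := cvg (rquot f x t @[t --> 0^'+]).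

Definition md_minus_exists (R : realType) (X : normedModType R)
  (f : R -> X) (x : R) : Prop := cvg (lquot f x t @[t --> 0^'+]).

(* As [lim] is total, [md_plus], [md_minus] and [md] are only meaningful under
   the corresponding existence predicates; these require a finite limit. *)
Definition md_plus (R : realType) (X : normedModType R) (f : R -> X) (x : R)
  : R := lim (rquot f x t @[t --> 0^'+]).

Definition md_minus (R : realType) (X : normedModType R) (f : R -> X) (x : R)
  : R := lim (lquot f x t @[t --> 0^'+]).

Definition md_exists (R : realType) (X : normedModType R) (f : R -> X) (x : R)
  : Prop :=
  [/\ md_plus_exists f x, md_minus_exists f x & md_plus f x = md_minus f x].

Definition md (R : realType) (X : normedModType R) (f : R -> X) (x : R) : R :=
  md_plus f x.

(* Main.v *)
Require Import Defs.
From HB Require Import structures.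
From mathcomp Require Import all_boot all_order all_algebra.
From mathcomp Require Import all_classical all_reals all_analysis.
From mathcomp Require Import measurable_realfun ring lra.

(* The points where [mDplus f] is finite lie in countably many sets [S] of small
   diameter on which [|f (x + t) - f x| <= L t] for all small [t > 0]; in
   particular [f] is [L]-Lipschitz on [S].

   Let [d_n] be dense in [S] and let [phi_n] be the McShane extension to the
   line of [|f - f (d_n)|] restricted to [S]. By Radon-Nikodym and Lebesgue
   differentiation, the Lipschitz function [phi_n] is derivable almost
   everywhere and is the integral of its derivative. Put [m := sup_n |phi_n'|].
   For [s <= t] in [S], [|f t - f s|] is at least [|phi_n t - phi_n s|] and at
   most the integral of [m] over [s, t]. Hence, at almost every [x] of [S], the
   quotient [|f y - f x| / |y - x|] tends to [m x] as [y] tends to [x] within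
   [S].

   At almost every [x] of [S] the set [S] is moreover not porous, so every [y]
   near [x] has a point [s] of [S] on its left at distance [o(|y - x|)]. The
   one-sided estimate at [s] gives [f y = f s + o(|y - x|)], hence the limit for
   all [y]. *)

Set Implicit Arguments.
Unset Strict Implicit.
Unset Printing Implicit Defensive.

Import Order.TTheory GRing.Theory Num.Theory.
Import numFieldNormedType.Exports.

Local Open Scope classical_set_scope.
Local Open Scope ring_scope.

Lemma ae_forall_countType d (T : sigmaRingType d) (R : realType)
    (mu : {measure set T -> \bar R}) (I : countType) (P : I -> T -> Prop) :
  (forall i, \forall x \ae mu, P i x) -> \forall x \ae mu, forall i, P i x.
Proof.
move=> aeP; have /ae_foralln : forall n, \forall x \ae mu,
    forall i, unpickle n = Some i -> P i x.
  move=> n; case: unpickle => [i|]; last exact: aeW.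
  by apply: filterS (aeP i) => x Pix _ [<-].
by apply: filterS => x Px i; apply: (Px (pickle i)); exact: pickleK.
Qed.

(* The library's hint for this instance does not fire on [lebesgue_measure]. *)
#[local] Instance lebesgue_ae_filter {R : realType} :
  Filter (almost_everywhere (@lebesgue_measure R)).
Proof. exact: ae_filter_ringOfSetsType. Qed.

Lemma ler_dist_distr {K : numDomainType} {V : normedZmodType K} (x y z : V) :
  `| `|x - z| - `|y - z| | <= `|x - y|.
Proof. by apply: le_trans (ler_dist_dist _ _) _; rewrite opprB addrA subrK. Qed.

Lemma cvg_limf_esup {I : choiceType} {T : filteredType I} {R : realType}
    {F : set_system T} {FF : ProperFilter F} (g : T -> R) (l : R) :
  g @ F --> l -> limf_esup (EFin \o g) F = l%:E.
Proof.
move=> /cvgrPdist_le gl; apply/eqP; rewrite eq_le; apply/andP; split.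
  apply/lee_addgt0Pr => e e0.
  apply: (@le_trans _ _ (ereal_sup ((EFin \o g) @` [set t | g t <= l + e]))).
    apply: ereal_inf_lbound; exists [set t | g t <= l + e] => //.
    apply: filterS (gl e e0) => t; rewrite distrC.
    by move=> /(le_trans (ler_norm _)); rewrite lerBlDl.
  by apply: ge_ereal_sup => _ [t /= ? <-]; rewrite -EFinD lee_fin.
apply: le_ereal_inf_tmp => _ [V FV <-]; apply/lee_subgt0Pr => e e0.
have [t [Vt lt]] := filter_ex (filterI FV (gl e e0)).
apply: (@le_trans _ _ (g t)%:E); last by apply: ereal_sup_ubound; exists t.
by rewrite -EFinB lee_fin lerBlDr -lerBlDl (le_trans (ler_norm _)).
Qed.

Section klipschitz.
Context {R : realFieldType} {V W : normedModType R}.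
Implicit Types (f : V -> W) (S : set V) (k : R).

Lemma klipschitzP f S k :
  k.-lipschitz_S f <-> (forall s t, S s -> S t -> `|f s - f t| <= k * `|s - t|).
Proof.
split=> [fk s t Ss St|fk [s t] [/= Ss St]]; last exact: fk.
by apply: (fk (s, t)).
Qed.

Lemma klipschitz_continuous f k : k.-lipschitz f -> continuous f.
Proof.
move=> /klipschitzP fk x; apply/cvgrPdist_le => e e0.
have [k0|k0] := ltP 0 k; near=> y; apply: (le_trans (fk _ _ I I)).
  rewrite mulrC -ler_pdivlMr//; near: y.
  by apply: (@cvgr_dist_le _ _ _ _ _ id x); rewrite ?divr_gt0.
by apply: le_trans (ltW e0); rewrite mulr_le0_ge0.
Unshelve. all: by end_near. Qed.

End klipschitz.

Lemma klipschitz_ge0 {R : realFieldType} {W : normedModType R} (phi : R -> W)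
    (k : R) : k.-lipschitz phi -> 0 <= k.
Proof.
move=> /klipschitzP phik; have := phik 1 0 I I.
by rewrite subr0 normr1 mulr1; exact: le_trans.
Qed.

Section lebesgue_stieltjes.
Context {R : realType}.
Implicit Types (G H K : cumulative R R) (A : set (measurableTypeR R)).

Lemma lebesgue_stieltjes_measure_itvoc G (s t : R) : s <= t ->
  lebesgue_stieltjes_measure G `]s, t]%classic = (G t - G s)%:E.
Proof.
move=> st; rewrite /lebesgue_stieltjes_measure /measure_extension.
by rewrite measurable_mu_extE/= ?wlength_itv_bnd//; exact: is_ocitv.
Qed.

Lemma lebesgue_stieltjes_measureD G H K : K =1 G \+ H ->
  forall A, measurable A -> (lebesgue_stieltjes_measure K A =
  lebesgue_stieltjes_measure G A + lebesgue_stieltjes_measure H A)%E.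
Proof.
move=> KGH A mA; rewrite -[RHS]measure_addE.
apply: lebesgue_stieltjes_measure_unique => //= X /ocitvP[->|[[s t] /= st ->]].
  by rewrite !measure0.
rewrite [RHS]measure_addE /= !lebesgue_stieltjes_measure_itvoc ?ltW//.
rewrite -EFinD !KGH/=.
by congr EFin; ring.
Qed.

Lemma lebesgue_stieltjes_measureZ G K (k : {nonneg R}) :
  (forall x, K x = k%:num * G x) -> forall A, measurable A ->
  (lebesgue_stieltjes_measure K A =
  k%:num%:E * lebesgue_stieltjes_measure G A)%E.
Proof.
move=> KG A mA; rewrite -[RHS]/(mscale k (lebesgue_stieltjes_measure G) A).
apply: lebesgue_stieltjes_measure_unique => //= X /ocitvP[->|[[s t] /= st ->]].
  by rewrite !measure0.
rewrite [RHS]/mscale/= !lebesgue_stieltjes_measure_itvoc ?ltW// -EFinM !KG.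
by rewrite mulrBr.
Qed.

Lemma lebesgue_stieltjes_measure_le_klipschitz G (k : R) : k.-lipschitz G ->
  forall A, measurable A ->
  (lebesgue_stieltjes_measure G A <= k%:E * lebesgue_measure A)%E.
Proof.
move=> Gk A mA; have /klipschitzP G_le := Gk.
have k0 := klipschitz_ge0 Gk.
have Kc : continuous (fun x : R => k * x) by move=> x; exact: mulrl_continuous.
have Kndecr : {homo (fun x : R => k * x) : x y / x <= y}.
  by move=> x y xy; exact: ler_wpM2l.
pose K : cumulative R R := HB.pack (fun x : R => k * x)
  (isCumulative.Build R _ R _ Kndecr (right_continuousW Kc)).
have Hc : continuous (fun x => k * x - G x).
  by move=> x; apply: cvgB; [exact: Kc|exact: klipschitz_continuous Gk x].
have Hndecr : {homo (fun x => k * x - G x) : x y / x <= y}.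
  move=> x y xy; have := le_trans (ler_norm _) (G_le y x I I).
  by rewrite ger0_norm ?subr_ge0//; lra.
pose H : cumulative R R := HB.pack (fun x => k * x - G x)
  (isCumulative.Build R _ R _ Hndecr (right_continuousW Hc)).
rewrite -(@lebesgue_stieltjes_measureZ idfun K (NngNum k0))//.
rewrite (@lebesgue_stieltjes_measureD G H K)//; first by rewrite leeDl.
by move=> x /=; ring.
Qed.

End lebesgue_stieltjes.

Section lipschitz_density.
Context {R : realType}.
Notation mu := (@lebesgue_measure R).
Implicit Types (phi : R -> R) (L a b : R).

Lemma nondecreasing_lipschitz_density phi L a b :
  {homo phi : x y / x <= y} -> L.-lipschitz phi ->
  exists2 g : R -> R, mu.-integrable setT (EFin \o g) &
    forall s t, a <= s -> s <= t -> t <= b ->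
      phi t - phi s = \int[mu]_(x in `]s, t]) g x.
Proof.
move=> ndphi phiL; have phic := klipschitz_continuous phiL.
pose G : cumulative R R := HB.pack phi
  (isCumulative.Build R _ R _ ndphi (right_continuousW phic)).
pose D : set (measurableTypeR R) := `]a, b]%classic.
have mD : measurable D by exact: measurable_itv.
have D_fin : (lebesgue_stieltjes_measure G D < +oo)%E.
  have [ab|ab] := leP a b.
    by rewrite lebesgue_stieltjes_measure_itvoc ?ltry.
  by rewrite /D set_itv_ge ?measure0// bnd_simp -leNgt ltW.
pose nu : {finite_measure set _ -> \bar R} := mfrestr mD D_fin.
have nuE A : measurable A -> A `<=` D -> nu A = lebesgue_stieltjes_measure G A.
  by move=> mA AD; rewrite /nu/= /mfrestr /mrestr setIidl.
have nu_mu : nu `<< mu.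
  apply/null_content_dominatesP => A mA A0.
  have GA0 := lebesgue_stieltjes_measure_le_klipschitz (G := G) phiL mA.
  rewrite A0 mule0 in GA0.
  apply/eqP; rewrite eq_le measure_ge0 andbT (le_trans _ GA0)//.
  by apply: le_measure; rewrite ?inE//; exact: measurableI.
have [g [_ g_fin g_int gE]] := radon_nikodym_sigma_finite nu_mu.
have fine_g : EFin \o (fine \o g) = g by apply/funext => x /=; rewrite fineK.
exists (fine \o g); first by rewrite fine_g.
move=> s t sa st tb.
rewrite /Rintegral (_ : (fun x => ((fine \o g) x)%:E) = g)// -gE// nuE//.
  by rewrite lebesgue_stieltjes_measure_itvoc.
by apply: subset_itv; rewrite bnd_simp.
Qed.

Lemma bounded_integrable_itvoc (g : R -> R) L a b :
  measurable_fun setT g -> (forall x, `|g x| <= L) ->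
  mu.-integrable `]a, b] (EFin \o g).
Proof.
move=> mg gL; apply: measurable_bounded_integrable => //.
- by rewrite /= lebesgue_measure_itv/=; case: ifPn => _; rewrite ?ltry.
- exact: measurable_funTS.
- exists L; split=> [|M LM x _ /=]; first exact: num_real.
  by rewrite (le_trans (gL x))// ltW.
Qed.

Lemma lipschitz_density phi L a b : L.-lipschitz phi ->
  exists2 g : R -> R, mu.-integrable `]a, b] (EFin \o g) &
    forall s t, a <= s -> s <= t -> t <= b ->
      phi t - phi s = \int[mu]_(x in `]s, t]) g x.
Proof.
move=> phi_lipschitz; have /klipschitzP phiL := phi_lipschitz.
have L0 := klipschitz_ge0 phi_lipschitz; pose G x := phi x + L * x.
have ndG : {homo G : x y / x <= y}.
  move=> x y xy; have := le_trans (ler_norm _) (phiL x y I I).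
  by rewrite distrC (ger0_norm (_ : 0 <= y - x)) ?subr_ge0// /G; lra.
have GL : (L + L).-lipschitz G.
  apply/klipschitzP => x y _ _; rewrite /G opprD addrACA -mulrBr mulrDl.
  apply: le_trans (ler_normD _ _) (lerD (phiL _ _ I I) _).
  by rewrite normrM ger0_norm.
have [g gint gE] := nondecreasing_lipschitz_density a b ndG GL.
have int_itv (h : R -> R) s t : mu.-integrable setT (EFin \o h) ->
    mu.-integrable `]s, t] (EFin \o h) by exact: integrableS.
have int_cst s t : mu.-integrable `]s, t] (EFin \o cst L).
  by apply: (bounded_integrable_itvoc _ _ (L := `|L|)).
exists (fun x => g x - L) => [|s t sa st tb].
  by apply: (integrableB _ (int_itv _ _ _ gint) (int_cst a b)).
rewrite RintegralB ?Rintegral_cst -?gE//; last exact: int_itv.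
rewrite /= lebesgue_measure_itv/= lte_fin.
have [st'|] := ltP s t; first by rewrite /G /=; ring.
by move=> ts; have -> : t = s; [apply/eqP; rewrite eq_le ts|rewrite /=; ring].
Qed.

End lipschitz_density.

Section lebesgue_derivation.
Context {R : realType}.
Notation mu := (@lebesgue_measure R).
Implicit Types (phi g : R -> R) (L a b x : R).

Lemma ae_is_derive_integral phi g a b :
  mu.-integrable `]a, b] (EFin \o g) ->
  (forall s t, a <= s -> s <= t -> t <= b ->
    phi t - phi s = \int[mu]_(x in `]s, t]) g x) ->
  {ae mu, forall x, a < x < b -> is_derive x 1 phi (g x)}.
Proof.
move=> gint phiE; pose f := g \_ `]a, b].
have fint y : mu.-integrable `]a, y] (EFin \o f).
  rewrite /f -restrict_EFin; apply/integrable_restrict => //=.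
  by apply: integrableS gint => //; exact: measurableI.
have := FTC1 fint (integrable_locally (measurable_itv _) gint).
apply: filterS => x + /andP[ax xb]; rewrite lte_fin => /(_ ax).
set F := fun y => _; move=> [/derivableP dF]; rewrite derive1E => F'x.
have fx : f x = g x by rewrite /f patchE mem_set//= in_itv/= ax ltW.
have dFa : is_derive x 1 (F + cst (phi a)) (g x).
  by apply: is_derive_eq; rewrite addr0 F'x.
apply: near_eq_is_derive dFa; near=> y.
have ay : a < y by near: y; exact: lt_nbhsr.
have yb : y <= b by near: y; exact: lt_le_nbhsl.
have Fy : F y = \int[mu]_(t in `]a, y]) g t; last first.
  rewrite -[LHS]/(F y + phi a).
  by have := phiE a y; rewrite -Fy => <- //; [rewrite subrK|exact: ltW].
apply: eq_Rintegral => t; rewrite inE/= in_itv/= => /andP[ta ty].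
by rewrite /f patchE mem_set//= in_itv/= ta (le_trans ty).
Unshelve. all: by end_near. Qed.

Lemma is_derive_slope phi x c : is_derive x 1 phi c ->
  (phi y - phi x) / (y - x) @[y --> x^'] --> c.
Proof.
move=> dphi; apply/cvgr_dnbhsP => u [ux u_x].
have : (fun h => h^-1 *: ((phi \o shift x) (h *: 1) - phi x)) @ 0^' --> c.
  by rewrite -[X in _ --> X]derive_val; exact: ex_derive.
move=> /cvgr_dnbhsP/(_ (fun n => u n - x)) /= slope_c.
under eq_fun => n do
  rewrite mulrC -[in phi (u n)](subrK x (u n)) -[X in phi (X + _)]mulr1.
apply: slope_c; split=> [n|]; first by rewrite subr_eq0.
by rewrite -[X in _ --> X](subrr x); apply: cvgB => //; exact: cvg_cst.
Qed.

Lemma is_derive_min phi x c : is_derive x 1 phi c ->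
  (\forall y \near x, phi x <= phi y) -> c = 0.
Proof.
move=> /is_derive_slope slope_c phi_min.
apply/eqP; rewrite eq_le; apply/andP; split.
  have /cvgr_to_le := cvg_dnbhs_at_left slope_c; apply.
  rewrite near_withinE; apply: filterS phi_min => y xy /= yx.
  by rewrite mulr_ge0_le0 ?invr_le0 ?subr_ge0// subr_le0 ltW.
have /cvgr_to_ge := cvg_dnbhs_at_right slope_c; apply.
rewrite near_withinE; apply: filterS phi_min => y xy /= yx.
by rewrite divr_ge0 ?subr_ge0// ltW.
Qed.

Lemma norm_limn_sup_le (u : R^nat) L : (forall n, `|u n| <= L) ->
  `|limn_sup u| <= L.
Proof.
move=> uL; have u_bounded : bounded_fun u.
  exists L; split=> [|M LM n _ /=]; first exact: num_real.
  by rewrite (le_trans (uL n))// ltW.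
have u_le n : u n <= sups u n.
  apply: ub_le_sup; last by exists n => /=.
  exact/has_ubound_sdrop/bounded_fun_has_ubound.
have sups_ge n : - L <= sups u n.
  by apply: le_trans (u_le n); have := uL n; rewrite ler_norml => /andP[].
rewrite limn_supE// ler_norml; apply/andP; split.
  by apply: lb_le_inf; [exists (sups u 0%N), 0%N|move=> _ [n _ <-]].
apply: (@le_trans _ _ (sups u 0%N)).
  by apply: ge_inf; [exists (- L) => _ [n _ <-]|exists 0%N].
apply: ge_sup; first by exists (u 0%N), 0%N.
by move=> _ [n _ <-]; apply: le_trans (uL n); exact: ler_norm.
Qed.

(* For a Lipschitz [phi] this is a bounded Borel function, whereas [phi^`()]
   takes junk values where [phi] is not derivable. *)
Definition limsup_slope phi x : R :=
  limn_sup (fun n => (phi (x + harmonic n) - phi x) / harmonic n).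

Lemma is_derive_limsup_slope phi x c :
  is_derive x 1 phi c -> limsup_slope phi x = c.
Proof.
move=> /is_derive_slope /cvgr_dnbhsP dphi.
have slope_c : (phi (x + harmonic n) - phi x) / harmonic n @[n --> \oo] --> c.
  under eq_fun => n do rewrite -[X in _ / X](addKr x) [- x + _]addrC.
  apply: (dphi (fun n => x + harmonic n)); split=> [n|].
    by rewrite -subr_eq0 [_ - x]addrC addKr gt_eqF// invr_gt0.
  rewrite -[X in _ --> X]addr0.
  by apply: cvgD; [exact: cvg_cst|exact: cvg_harmonic].
by rewrite /limsup_slope cvg_limn_supE; [exact/cvg_lim|exact: cvgP slope_c].
Qed.

Section lipschitz.
Variables (phi : R -> R) (L : R).
Hypothesis phiL : L.-lipschitz phi.

Let slope_le x n : `|(phi (x + harmonic n) - phi x) / harmonic n| <= L.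
Proof.
have hn : 0 < harmonic n :> R by rewrite invr_gt0.
rewrite normrM normfV (gtr0_norm hn) ler_pdivrMr//.
have /klipschitzP/(_ (x + harmonic n) x I I) := phiL.
by rewrite [x + _ - x]addrC addKr (gtr0_norm hn).
Qed.

Lemma norm_limsup_slope_le x : `|limsup_slope phi x| <= L.
Proof. exact: norm_limn_sup_le. Qed.

Lemma measurable_limsup_slope : measurable_fun setT (limsup_slope phi).
Proof.
have mphi : measurable_fun setT phi.
  by apply: continuous_measurable_fun; exact: klipschitz_continuous phiL.
apply: measurable_fun_limn_sup => [x _|x _|n].
- by exists L => _ [n _ <-]; exact: le_trans (ler_norm _) (slope_le x n).
- exists (- L) => _ [n _ <-].
  by have := slope_le x n; rewrite ler_norml => /andP[].
- apply: measurable_funM => //; apply: measurable_funB => //.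
  by apply: measurableT_comp => //; exact: measurable_funD.
Qed.

Lemma lipschitz_FTC2 s t : s <= t ->
  phi t - phi s = \int[mu]_(x in `]s, t]) limsup_slope phi x.
Proof.
move=> st; have [g gint gE] := lipschitz_density s (t + 1) phiL.
rewrite gE// ?lerDl// /Rintegral; congr fine; apply: ae_eq_integral => //.
- apply/measurable_EFinP; have /integrableP[/measurable_EFinP + _] := gint.
  by apply: measurable_funS => //; apply: subset_itv; rewrite bnd_simp ?lerDl.
- by apply/measurable_EFinP/measurable_funTS; exact: measurable_limsup_slope.
have := ae_is_derive_integral gint gE.
apply: filterS => x dphi; rewrite /= in_itv/= => /andP[sx xt].
by rewrite (is_derive_limsup_slope (dphi _))// sx (le_lt_trans xt)// ltrDl.
Qed.

Lemma ae_is_derive_lipschitz :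
  {ae mu, forall x, is_derive x 1 phi (limsup_slope phi x)}.
Proof.
have /ae_foralln : forall n : nat, {ae mu, forall x, - n%:R < x < n%:R ->
    is_derive x 1 phi (limsup_slope phi x)}.
  move=> n; have [g gint gE] := lipschitz_density (- n%:R) n%:R phiL.
  have := ae_is_derive_integral gint gE.
  apply: filterS => x dphi /dphi dgx.
  by rewrite (is_derive_limsup_slope dgx).
apply: filterS => x /(_ (Num.bound `|x|)); apply.
by rewrite -ltr_norml; exact: archi_boundP.
Qed.

End lipschitz.
End lebesgue_derivation.

Section metric_derivative.
Context {R : realFieldType} {X : normedModType R}.
Implicit Types (f : R -> X) (S : set R) (x m : R).

Definition is_metric_derivative S f x m : Prop :=
  `|f y - f x| / `|y - x| @[y --> within S x^'] --> m.

Lemma is_metric_derivativeP S f x m : is_metric_derivative S f x m <->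
  forall e : R, 0 < e -> \forall y \near x, S y ->
    `| `|f y - f x| - m * `|y - x| | <= e * `|y - x|.
Proof.
have quotE (e y : R) : y != x -> (`|m - `|f y - f x| / `|y - x| | <= e) =
    (`| `|f y - f x| - m * `|y - x| | <= e * `|y - x|).
  rewrite -subr_eq0 -normr_gt0 => yx; rewrite -(ler_pM2r yx) distrC.
  by rewrite -[X in _ * X <= _](gtr0_norm yx) -normrM mulrBl divfK ?gt_eqF.
split=> [/cvgrPdist_le fm e e0|fm].
  have := fm e e0; rewrite !near_withinE; apply: filterS => y fy Sy.
  have [->|yx] := eqVneq y x.
    by rewrite !subrr !normr0 !mulr0 subrr normr0.
  by rewrite -quotE//; exact: fy.
apply/cvgrPdist_le => e e0; have := fm e e0.
rewrite !near_withinE; apply: filterS => y fy yx Sy.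
by rewrite quotE//; exact: fy.
Qed.

End metric_derivative.

Lemma is_derive_metric_derivative {R : realType} (phi : R -> R) (x c : R) :
  is_derive x 1 phi c -> is_metric_derivative setT phi x `|c|.
Proof.
move=> /is_derive_slope /cvg_norm; rewrite /is_metric_derivative => phic.
under eq_fun do rewrite -normfV -normrM.
by apply: cvg_trans phic; apply: cvg_app; exact: cvg_within.
Qed.

Section mcshane.
Context {R : realType} {V : normedModType R}.
Variables (S : set V) (u : V -> R) (L : R).

Definition mcshane (t : V) : R := inf [set u s + L * `|t - s| | s in S].

Hypotheses (L0 : 0 <= L) (S0 : S !=set0) (uL : L.-lipschitz_S u).

Let has_inf_mcshane t : has_inf [set u s + L * `|t - s| | s in S].
Proof.
case: S0 => s0 Ss0; split; first by exists (u s0 + L * `|t - s0|), s0.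
exists (u s0 - L * `|t - s0|) => _ [s Ss <-].
have /klipschitzP/(_ _ _ Ss0 Ss) := uL; rewrite ler_norml => /andP[_ u_le].
have : L * `|s0 - s| <= L * `|t - s0| + L * `|t - s|.
  by rewrite -mulrDr ler_wpM2l// (distrC t s0) ler_distD.
by lra.
Qed.

Lemma mcshane_le t s : S s -> mcshane t <= u s + L * `|t - s|.
Proof.
by move=> Ss; apply: ge_inf; [have [] := has_inf_mcshane t|exists s].
Qed.

Lemma le_mcshane t c : (forall s, S s -> c <= u s + L * `|t - s|) ->
  c <= mcshane t.
Proof.
move=> c_le; apply: lb_le_inf; first by have [] := has_inf_mcshane t.
by move=> _ [s Ss <-]; exact: c_le.
Qed.

Lemma mcshaneE t : S t -> mcshane t = u t.
Proof.
move=> St; apply/eqP; rewrite eq_le; apply/andP; split.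
  by have := mcshane_le t St; rewrite subrr normr0 mulr0 addr0.
apply: le_mcshane => s Ss.
have /klipschitzP/(_ _ _ St Ss) := uL; rewrite ler_norml => /andP[_].
by rewrite lerBlDr addrC.
Qed.

Lemma mcshane_lipschitz : L.-lipschitz mcshane.
Proof.
have mcshane_dist t t' : mcshane t - mcshane t' <= L * `|t - t'|.
  rewrite lerBlDr -lerBlDl; apply: le_mcshane => s Ss.
  have := mcshane_le t Ss.
  have : L * `|t - s| <= L * `|t - t'| + L * `|t' - s|.
    by rewrite -mulrDr ler_wpM2l// ler_distD.
  by lra.
apply/klipschitzP => t t' _ _; rewrite ler_norml mcshane_dist andbT.
by rewrite lerNl opprB distrC mcshane_dist.
Qed.

Lemma mcshane_adherent t (e : R) : 0 < e ->
  exists2 s, S s & u s + L * `|t - s| < mcshane t + e.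
Proof.
move=> e0; have [_ [s Ss <-] ?] := inf_adherent e0 (has_inf_mcshane t).
by exists s.
Qed.

End mcshane.

Definition nonporous {R : realFieldType} {V : normedModType R} (S : set V)
    (x : V) : Prop :=
  forall e : R, 0 < e ->
    \forall y \near x, exists2 s, S s & `|y - s| <= e * `|y - x|.

Section nonporous.
Context {R : realType}.
Notation mu := (@lebesgue_measure R).
Implicit Types (S : set R) (x : R).

(* The distance to [S] is 1-Lipschitz and minimal on [S], so its derivative
   vanishes at almost every point of [S]. *)
Lemma ae_nonporous S : {ae mu, forall x, S x -> nonporous S x}.
Proof.
have [->|/set0P S0] := eqVneq S set0; first exact: aeW.
have cst_lipschitz : 1.-lipschitz_S (cst 0 : R -> R).
  by apply/klipschitzP => s t _ _; rewrite subrr normr0 mul1r.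
pose D := mcshane S (cst 0) 1.
have DE x : S x -> D x = 0 by exact: mcshaneE.
have D_ge0 y : 0 <= D y by apply: le_mcshane => // s _; rewrite add0r mul1r.
have := ae_is_derive_lipschitz (mcshane_lipschitz ler01 S0 cst_lipschitz).
apply: filterS => x; rewrite -/D => dD Sx e e0.
have D'x0 : limsup_slope D x = 0.
  by apply: (is_derive_min dD); near=> y; rewrite DE.
have /is_metric_derivativeP D'x := is_derive_metric_derivative dD.
have e2_gt0 : 0 < e / 2 by rewrite divr_gt0.
have := D'x _ e2_gt0; apply: filterS => y /(_ I).
rewrite (DE x)// D'x0 normr0 mul0r !subr0 normr_id ger0_norm// => Dy.
have [->|yx] := eqVneq y x; first by exists x; rewrite ?subrr ?normr0 ?mulr0.
have eyx0 : 0 < e / 2 * `|y - x| by rewrite mulr_gt0// normr_gt0 subr_eq0.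
have [s Ss] := mcshane_adherent ler01 S0 cst_lipschitz y eyx0.
by rewrite add0r mul1r -/D => ys; exists s => //; lra.
Unshelve. all: by end_near. Qed.

Lemma nonporous_left S x : nonporous S x -> forall e : R, 0 < e ->
  \forall y \near x, y != x -> exists2 s, S s & 0 < y - s <= e * `|y - x|.
Proof.
move=> Sx e e0; pose k := Num.min 1 e.
have k0 : 0 < k by rewrite lt_min ltr01.
have /nbhs_ballP[d /= d0 dS] := Sx (k / 8) (divr_gt0 k0 (ltr0Sn _ 7)).
near=> y; rewrite -subr_eq0 -normr_gt0; set h := `|y - x| => h0.
have k_le1 : k <= 1 by rewrite ge_min lexx.
have kh_le : k * h <= e * h by rewrite ler_pM2r// ge_min lexx orbT.
have kh_leh : k * h <= h by rewrite ler_piMl// ltW.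
have kh0 : 0 < k * h by exact: mulr_gt0.
have hd : h < d / 2.
  by rewrite /h distrC; near: y; apply: nbhsx_ballx; rewrite divr_gt0.
have y'x : `|y - k * h / 2 - x| <= 2 * h.
  rewrite addrAC; apply: le_trans (ler_normB _ _) _; rewrite -/h.
  by rewrite ger0_norm; lra.
have [|s Ss ys] := dS (y - k * h / 2); first by rewrite /ball/= distrC; lra.
exists s => //.
have : `|y - k * h / 2 - s| <= k * h / 4.
  apply: le_trans ys _; have : k / 8 * `|y - k * h / 2 - x| <= k / 8 * (2 * h).
    by rewrite ler_pM2l// divr_gt0.
  by lra.
by rewrite ler_norml; lra.
Unshelve. all: by end_near. Qed.

End nonporous.

Section metric_speed.
Context {R : realType} {X : normedModType R}.
Notation mu := (@lebesgue_measure R).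
Implicit Types (f : R -> X) (S : set R) (m : R -> R) (L x : R).

Lemma exists_dense_sequence S : S !=set0 ->
  exists2 d : nat -> R, (forall n, S (d n)) & S `<=` closure (range d).
Proof.
move=> [s0 Ss0].
pose I (pq : rat * rat) := S `&` `]ratr pq.1, ratr pq.2[%classic.
have /choice[c cP] pq : exists c, S c /\ (I pq !=set0 -> I pq c).
  have [[s Is]|I0] := pselect (I pq !=set0); last by exists s0.
  by exists s; case: (Is).
exists (fun n => if unpickle n is Some pq then c pq else s0).
  by move=> n; case: unpickle => // pq; have [] := cP pq.
move=> x Sx B /nbhs_ballP[e /= e0 eB].
have [|p] := @rat_in_itvoo R (x - e) x; first by rewrite ltrBlDr ltrDl.
rewrite in_itv/= => /andP[ep px].
have [|q] := @rat_in_itvoo R x (x + e); first by rewrite ltrDl.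
rewrite in_itv/= => /andP[xq qe].
have [_ []] := cP (p, q); first by exists x; split; rewrite //= in_itv/= px xq.
rewrite /= in_itv/= => _ /andP[pc cq].
exists (c (p, q)); split; first by exists (pickle (p, q)); rewrite ?pickleK.
by apply: eB; rewrite /ball/= ltr_norml; lra.
Qed.

(* The integral of [m] from a base point far to the left is a nondecreasing
   function with derivative [m] that dominates the increments of [f] on [S]. *)
Lemma ae_dist_le_density f S m L : measurable_fun setT m ->
  (forall x, 0 <= m x <= L) ->
  (forall s t, S s -> S t -> s <= t ->
    `|f t - f s| <= \int[mu]_(x in `]s, t]) m x) ->
  {ae mu, forall x, S x -> forall e : R, 0 < e -> \forall y \near x, S y ->
    `|f y - f x| <= (m x + e) * `|y - x|}.
Proof.
move=> mm m0L fm.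
have m_le x : `|m x| <= L by have /andP[? ?] := m0L x; rewrite ger0_norm.
have m_int s t := bounded_integrable_itvoc s t mm m_le.
pose M (k : nat) y := \int[mu]_(t in `](- k%:R), y]) m t.
have ME k s t : - k%:R <= s -> s <= t -> t <= k%:R ->
    M k t - M k s = \int[mu]_(x in `]s, t]) m x.
  by move=> ks st _; rewrite /M Rintegral_itvB ?bnd_simp.
have /ae_foralln := fun k => ae_is_derive_integral (m_int _ _) (ME k).
apply: filterS => x dM Sx e e0; pose k := Num.bound `|x|.
have /andP[kx xk] : - k%:R < x < k%:R by rewrite -ltr_norml archi_boundP.
have := dM k; rewrite kx xk => /(_ isT) /is_derive_metric_derivative.
move=> /is_metric_derivativeP/(_ e e0) M'x.
near=> y => Sy.
have yk : y <= k%:R by near: y; exact: lt_le_nbhsl.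
have ky : - k%:R <= y by near: y; exact: lt_le_nbhsr.
have fM : `|f y - f x| <= `|M k y - M k x|.
  have [xy|/ltW yx] := leP x y.
    by rewrite (le_trans _ (ler_norm _))// ME ?fm// ltW.
  by rewrite distrC (distrC (M k y)) (le_trans _ (ler_norm _))// ME ?fm// ltW.
have : `| `|M k y - M k x| - `|m x| * `|y - x| | <= e * `|y - x|.
  by near: y; apply: filterS M'x => y; exact.
have /andP[m0 _] := m0L x; rewrite (ger0_norm m0) => /(le_trans (ler_norm _)).
by lra.
Unshelve. all: by end_near. Qed.

Section lipschitz_on.
Variables (f : R -> X) (S : set R) (L : R) (d : nat -> R).
Hypotheses (L0 : 0 <= L) (fL : L.-lipschitz_S f).
Hypotheses (Sd : forall n, S (d n)) (d_dense : S `<=` closure (range d)).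

Definition dist_extension n : R -> R :=
  mcshane S (fun t => `|f t - f (d n)|) L.

Definition metric_speed x : R :=
  sup (range (fun n => `|limsup_slope (dist_extension n) x|)).

Let dist_lipschitz n : L.-lipschitz_S (fun t => `|f t - f (d n)|).
Proof.
apply/klipschitzP => s t Ss St.
have /klipschitzP/(_ _ _ Ss St) := fL.
by apply: le_trans; exact: ler_dist_distr.
Qed.

Let S0 : S !=set0. Proof. by exists (d 0%N). Qed.

Let dist_extensionE n t : S t -> dist_extension n t = `|f t - f (d n)|.
Proof. exact: mcshaneE. Qed.

Let dist_extension_lipschitz n : L.-lipschitz (dist_extension n).
Proof. exact: mcshane_lipschitz. Qed.

Let has_sup_speed x :
  has_sup (range (fun n => `|limsup_slope (dist_extension n) x|)).
Proof.
split; first by exists `|limsup_slope (dist_extension 0) x|, 0%N.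
by exists L => _ [n _ <-]; exact: norm_limsup_slope_le.
Qed.

Lemma metric_speed_ge n x :
  `|limsup_slope (dist_extension n) x| <= metric_speed x.
Proof. by apply: ub_le_sup; [have [] := has_sup_speed x|exists n]. Qed.

Lemma metric_speed_ge0_le x : 0 <= metric_speed x <= L.
Proof.
rewrite (le_trans (normr_ge0 _) (metric_speed_ge 0%N x)) /=.
apply: ge_sup; first by have [] := has_sup_speed x.
by move=> _ [n _ <-]; exact: norm_limsup_slope_le.
Qed.

Lemma measurable_metric_speed : measurable_fun setT metric_speed.
Proof.
rewrite (_ : metric_speed = fun x =>
    sups (fun n => `|limsup_slope (dist_extension n) x|) 0).
  apply: measurable_fun_sups => [x _|n]; first by have [] := has_sup_speed x.
  by apply: measurableT_comp => //; exact: measurable_limsup_slope.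
apply/funext => x; rewrite /sups/= /sdrop; congr (sup (_ @` _)).
by apply/seteqP; split.
Qed.

Lemma dist_le_integral_speed s t : S s -> S t -> s <= t ->
  `|f t - f s| <= \int[mu]_(x in `]s, t]) metric_speed x.
Proof.
move=> Ss St st; apply/ler_addgt0Pr => e e0.
pose r := e / (2 * (L + 1)).
have r0 : 0 < r by rewrite divr_gt0// mulr_gt0// ltr_wpDl.
have [_ [[n _ <-] sdn]] := d_dense Ss (nbhsx_ballx s r r0).
have fsd : `|f s - f (d n)| <= e / 2.
  have /klipschitzP/(_ _ _ Ss (Sd n)) := fL; move=> /le_trans; apply.
  rewrite (@le_trans _ _ (L * r))// ?ler_wpM2l//; first exact: ltW.
  have -> : e / 2 = (L + 1) * r by rewrite /r; field; rewrite gt_eqF// ltr_wpDl.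
  by rewrite ler_pM2r// lerDl.
have : dist_extension n t - dist_extension n s <=
    \int[mu]_(x in `]s, t]) metric_speed x.
  rewrite (lipschitz_FTC2 (dist_extension_lipschitz n) st).
  apply: le_Rintegral => //.
  - apply: (bounded_integrable_itvoc (L := L)) => [|x].
      exact: measurable_limsup_slope.
    exact: norm_limsup_slope_le.
  - apply: (bounded_integrable_itvoc (L := L)) => [|x].
      exact: measurable_metric_speed.
    by have /andP[? ?] := metric_speed_ge0_le x; rewrite ger0_norm.
  - by move=> x _; exact: le_trans (ler_norm _) (metric_speed_ge n x).
rewrite !dist_extensionE//.
have : `|f t - f s| <= `|f t - f (d n)| + `|f s - f (d n)|.
  by rewrite (distrC (f s)) ler_distD.
by lra.
Qed.

Lemma ae_metric_speed_le_dist :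
  {ae mu, forall x, S x -> forall e : R, 0 < e -> \forall y \near x, S y ->
    (metric_speed x - e) * `|y - x| <= `|f y - f x|}.
Proof.
have /ae_foralln :=
  fun n => ae_is_derive_lipschitz (dist_extension_lipschitz n).
apply: filterS => x dphi Sx e e0.
have e2_gt0 : 0 < e / 2 by rewrite divr_gt0.
have [_ [n _ <-] speed_lt] := sup_adherent e2_gt0 (has_sup_speed x).
have /is_derive_metric_derivative/is_metric_derivativeP/(_ _ e2_gt0) := dphi n.
apply: filterS => y /(_ I) + Sy; rewrite !dist_extensionE// distrC.
move=> /(le_trans (ler_norm _)); rewrite lerBlDr.
have := ler_dist_distr (f y) (f x) (f (d n)).
have : (metric_speed x - e / 2) * `|y - x| <=
    `|limsup_slope (dist_extension n) x| * `|y - x|.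
  by rewrite ler_wpM2r// ltW.
by lra.
Qed.

End lipschitz_on.

Lemma ae_is_metric_derivative_within f S L : 0 <= L -> L.-lipschitz_S f ->
  {ae mu, forall x, S x -> exists m : R, is_metric_derivative S f x m}.
Proof.
move=> L0 fL; have [->|/set0P S0] := eqVneq S set0; first exact: aeW.
have [d Sd d_dense] := exists_dense_sequence S0.
have f_ge := ae_metric_speed_le_dist L0 fL Sd.
have f_le := ae_dist_le_density (measurable_metric_speed L0 fL Sd)
  (metric_speed_ge0_le L0 fL Sd) (dist_le_integral_speed L0 fL Sd d_dense).
apply: filterS2 f_ge f_le => x + + Sx => /(_ Sx) f_ge /(_ Sx) f_le.
exists (metric_speed f S L d x); apply/is_metric_derivativeP => e e0.
apply: filterS2 (f_ge e e0) (f_le e e0) => y + + Sy => /(_ Sy) + /(_ Sy).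
by rewrite ler_norml; lra.
Qed.

End metric_speed.

Section metric_derivability.
Context {R : realType} {X : normedModType R}.
Notation mu := (@lebesgue_measure R).
Implicit Types (f : R -> X) (S : set R) (L r m x : R).

Definition right_klipschitz L r f : set R :=
  [set x | forall t, 0 < t < r -> `|f (x + t) - f x| <= L * t].

Lemma metric_remainder_le f x y s m :
  `| `|f y - f x| - m * `|y - x| | <=
  `| `|f s - f x| - m * `|s - x| | + `|f y - f s| + `|m| * `|y - s|.
Proof.
have -> : `|f y - f x| - m * `|y - x| = `|f s - f x| - m * `|s - x| +
    (`|f y - f x| - `|f s - f x|) + m * (`|s - x| - `|y - x|) by ring.
apply: le_trans (ler_normD _ _) (lerD _ _); last first.
  by rewrite normrM ler_wpM2l// (distrC y s) ler_dist_distr.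
by apply: le_trans (ler_normD _ _) _; rewrite lerD2l ler_dist_distr.
Qed.

(* The bound at [s] only sees the points on its right, so [f y] is compared with
   [f s] for a point [s] of [S] slightly to the left of [y]. *)
Lemma nonporous_is_metric_derivative f S L r x m : 0 <= L -> 0 < r ->
  S `<=` right_klipschitz L r f -> nonporous S x ->
  is_metric_derivative S f x m -> is_metric_derivative setT f x m.
Proof.
move=> L0 r0 SL /nonporous_left Sx /is_metric_derivativeP fm.
apply/is_metric_derivativeP => e e0.
pose C := L + 2 + `|m|; have C0 : 0 < C by rewrite ltr_pwDl// ltr_wpDl.
pose k := Num.min 1 (e / C).
have k0 : 0 < k by rewrite lt_min ltr01 divr_gt0.
have k1 : k <= 1 by rewrite ge_min lexx.
have Ck : C * k <= e by rewrite mulrC -ler_pdivlMr// ge_min lexx orbT.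
have /nbhs_ballP[d /= d0 fd] := fm k k0.
have Sxk := Sx k k0.
near=> y => _; have [->|yx] := eqVneq y x.
  by rewrite !subrr !normr0 !mulr0 subrr normr0.
have [s Ss] : exists2 s, S s & 0 < y - s <= k * `|y - x|.
  by move: yx; near: y; exact: Sxk.
have : `|y - x| < Num.min (d / 2) r.
  by rewrite distrC; near: y; apply: nbhsx_ballx; rewrite lt_min r0 divr_gt0.
have h0 : 0 < `|y - x| by rewrite normr_gt0 subr_eq0.
have := metric_remainder_le f x y s m; move: h0.
set h := `|y - x| => h0 remainder_le.
rewrite lt_min => /andP[hd hr] /andP[ys0 ysk].
have kh : k * h <= h by rewrite ler_piMl// ltW.
have sx : `|s - x| <= 2 * h.
  have := ler_distD y s x; rewrite (distrC s y) (gtr0_norm ys0) -/h.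
  by lra.
have f_sx : `| `|f s - f x| - m * `|s - x| | <= 2 * (k * h).
  apply: le_trans (fd s _ Ss) _; last by rewrite mulrCA ler_pM2l.
  by rewrite /ball/= distrC; lra.
have f_ys : `|f y - f s| <= L * (k * h).
  rewrite -[y](subrKC s) (le_trans (SL _ Ss _ _))//; last by rewrite ler_wpM2l.
  by rewrite ys0; lra.
have m_ys : `|m| * `|y - s| <= `|m| * (k * h).
  by rewrite ler_wpM2l// gtr0_norm.
have Ckh : C * k * h <= e * h by rewrite ler_pM2r.
by apply: le_trans remainder_le _; move: Ckh; rewrite /C; lra.
Unshelve. all: by end_near. Qed.

Lemma ae_is_metric_derivative f L r : 0 <= L -> 0 < r ->
  {ae mu, forall x, right_klipschitz L r f x ->
    exists m, is_metric_derivative setT f x m}.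
Proof.
move=> L0 r0.
pose S (q : rat) := right_klipschitz L r f `&` `]ratr q, ratr q + r[.
have SL q : L.-lipschitz_(S q) f.
  suff fS s t : S q s -> S q t -> s < t -> `|f s - f t| <= L * `|s - t|.
    apply/klipschitzP => s t Ss St; have [st|ts|->] := ltgtP s t.
    - exact: fS.
    - by rewrite distrC (distrC s); exact: fS.
    - by rewrite !subrr !normr0 mulr0.
  rewrite /S /= !in_itv/= => -[fs /andP[qs _]] [_ /andP[_ tq]] st.
  rewrite distrC (distrC s) [X in L * X]gtr0_norm ?subr_gt0//.
  by rewrite -{1}(subrKC s t); apply: fs; lra.
have /ae_forall_countType : forall q, {ae mu, forall x, S q x ->
    exists m, is_metric_derivative setT f x m}.
  move=> q; have := ae_nonporous (S q).
  apply: filterS2 (ae_is_metric_derivative_within L0 (SL q)) => x dS pS Sx.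
  have [m fm] := dS Sx; exists m.
  apply: nonporous_is_metric_derivative L0 r0 _ (pS Sx) fm.
  exact: subIsetl.
apply: filterS => x + fx; have [|q] := @rat_in_itvoo R (x - r) x.
  by rewrite ltrBlDr ltrDl.
rewrite in_itv/= => /andP[rq qx] /(_ q); apply; split => //=.
by rewrite in_itv/= qx; lra.
Qed.

Lemma is_metric_derivative_cvg f x m : is_metric_derivative setT f x m ->
  (rquot f x t @[t --> 0^'+] --> m) /\ (lquot f x t @[t --> 0^'+] --> m).
Proof.
move=> /is_metric_derivativeP fm.
suff quot_cvg (g : R -> R) : (forall t, `|g t| = `|t|) ->
    (`|f (x + g t) - f x| / t) @[t --> 0^'+] --> m.
  by split; [exact: (quot_cvg id)|exact: (quot_cvg -%R (@normrN _ _))].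
move=> gE; apply/cvgrPdist_le => e e0.
have /nbhs_ballP[d /= d0 fd] := fm e e0.
near=> t; have t0 : 0 < t by near: t; exact: nbhs_right_gt.
have td : t < d by near: t; exact: nbhs_right_lt.
have := fd (x + g t); rewrite /ball/= opprD addNKr normrN addrAC subrr add0r gE.
rewrite (gtr0_norm t0) => /(_ td I) ft.
rewrite distrC -(ler_pM2r t0) -[X in _ * X](gtr0_norm t0) -normrM.
by rewrite mulrBl divfK ?gt_eqF.
Unshelve. all: by end_near. Qed.

Lemma mDplus_lty_right_klipschitz f x : (mDplus f x < +oo)%E ->
  exists n : nat, right_klipschitz n.+1%:R n.+1%:R^-1 f x.
Proof.
rewrite /mDplus limf_esupE => /ereal_inf_lt[_ [V V0 <-]] sup_lty.
pose M := fine (ereal_sup ((fun t : R => (rquot f x t)%:E) @` V)).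
have quot_le t : V t -> rquot f x t <= M.
  move=> Vt; rewrite -lee_fin fineK; first by apply: ereal_sup_ubound; exists t.
  rewrite fin_numElt sup_lty andbT (@lt_le_trans _ _ (rquot f x t)%:E) ?ltNyr//.
  by apply: ereal_sup_ubound; exists t.
have [d /= d0 dV] : exists2 d : R, 0 < d & forall t, 0 < t < d -> V t.
  move: V0 => /nbhs_ballP[d /= d0 dV]; exists d => // t /andP[t0 td].
  by apply: dV => //; rewrite /ball/= sub0r normrN gtr0_norm.
exists (Num.truncn (Num.max M d^-1)) => t.
have := truncnS_gt (Num.max M d^-1).
set n := _.+1; rewrite gt_max => /andP[/ltW Mn /ltW dn] /andP[t0 tn].
rewrite -ler_pdivrMr//; apply: le_trans Mn; apply/quot_le/dV.
by rewrite t0 (lt_le_trans tn)// -[leRHS]invrK lef_pV2 ?posrE ?invr_gt0.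
Qed.

End metric_derivability.

Theorem theorem3p5 (R : realType) (X : completeNormedModType R) (f : R -> X) :
  exists N : set R,
    (@lebesgue_measure R).-negligible N /\
    forall x : R, ~ N x -> (mDplus f x < +oo)%E ->
      md_exists f x /\ (md f x)%:E = mDplus f x.
Proof.
pose P (n : nat) x := right_klipschitz n.+1%:R n.+1%:R^-1 f x ->
  exists m, is_metric_derivative setT f x m.
have /ae_foralln aeP n : {ae @lebesgue_measure R, forall x, P n x}.
  by apply: ae_is_metric_derivative; rewrite ?invr_gt0.
exists (~` [set x | forall n, P n x]); split => // x /contrapT Px.
move=> /mDplus_lty_right_klipschitz[n /Px[m /is_metric_derivative_cvg[rm lm]]].
have rE : md_plus f x = m by exact/cvg_lim.
have lE : md_minus f x = m by exact/cvg_lim.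
split; last by rewrite /md rE; apply/esym/cvg_limf_esup.
by split; [exact: cvgP rm|exact: cvgP lm|rewrite rE lE].
Qed.
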